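(* Let $s\ge 2$ and let $H_1\bowtie\dots\bowtie H_s$ be the iterated matched product of left ideals constructed (see context) from data $p_i,r_i,n_i,Q_i,f_i,c_i$ $(1\le i\le s)$ and $v_s$. Then the left brace $H_1\bowtie\dots\bowtie H_s$ is simple if and only if $c_i-\operatorname{id}$ is an automorphism of $(\mathbb{Z}/(p_i^{r_i}))^{n_i}$ for all $1\le i\le s$.
   Context: A left brace is a set $B$ with operations $+,\cdot$ such that $(B,+)$ is an abelian group, $(B,\cdot)$ is a group and $a\cdot(b+c)+a=a\cdot b+a\cdot c$ for all $a,b,c\in B$; its lambda map is $\lambda_a(b)=ab-a$. An ideal of $B$ is a normal subgroup $I$ of $(B,\cdot)$ with $\lambda_b(a)\in I$ for all $a\in I$, $b\in B$. $B$ is simple if it is nonzero and its only ideals are $\{0\}$ and $B$. Data. Let $s\ge2$ and let $p_1,\dots,p_s$ be distinct primes with $p_1,\dots,p_{s-1}$ odd. For $1\le i\le s$ let $r_i,n_i$ be positive integers, $Q_i$ a non-degenerate quadratic form over $(\mathbb{Z}/(p_i^{r_i}))^{n_i}$ (i.e. the matrix of $b_i(\vec x,\vec y)=Q_i(\vec x+\vec y)-Q_i(\vec x)-Q_i(\vec y)$ in the standard basis is invertible), and $f_i$ an element of order $p_i^{r_i'}$, for some $0\le r_i'\le r_i$, of the orthogonal group of $Q_i$ (automorphisms $g$ with $Q_i(g(\vec x))=Q_i(\vec x)$). Let $q_i(\vec x_i,\mu_i)=\mu_i-Q_i(\vec x_i)$. Let $H_i=H(p_i^{r_i},n_i,Q_i,f_i)$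 be the left brace with additive group $(\mathbb{Z}/(p_i^{r_i}))^{n_i+1}$, elements written $(\vec x_i,\mu_i)$ with $\vec x_i\in(\mathbb{Z}/(p_i^{r_i}))^{n_i}$, $\mu_i\in\mathbb{Z}/(p_i^{r_i})$, lambda map $\lambda^{(i)}_{(\vec{x}_i,\mu_i)}(\vec{y}_i,\mu'_i)=(f_{i}^{q_{i}(\vec{x}_i,\mu_i)}(\vec{y}_i),\ \mu'_i+b_{i}(\vec{x}_i,f_{i}^{q_i(\vec{x}_i,\mu_i)}(\vec{y}_i)))$ and multiplication $h\cdot h'=h+\lambda^{(i)}_h(h')$. For $1\le i<s$ let $c_i$ be an element of order $p_{i+1}^{r_{i+1}}$ of the orthogonal group of $Q_i$; let $c_s$ be an element of order $p_1^{r_1}$ of $\operatorname{Aut}((\mathbb{Z}/(p_s^{r_s}))^{n_s})$ and $v_s\in(\mathbb{Z}/(p_s^{r_s}))^{n_s}$ with $Q_s(c_s(\vec x))=Q_s(\vec x)+v_s\vec x^{\,t}$ for all $\vec x$ (vectors are rows, $t$ denotes transpose). Assume $f_ic_i=c_if_i$ for $1\le i\le s$. Actions. For $1\le i,j\le s$ define homomorphisms $\alpha^{(j,i)}\colon(H_j,\cdot)\to\operatorname{Aut}(H_i,+)$ by $\alpha^{(k+1,k)}_{(\vec{x}_{k+1},\mu_{k+1})}(\vec{x}_k,\mu_k)=(c_{k}^{q_{k+1}(\vec{x}_{k+1},\mu_{k+1})}(\vec{x}_k),\mu_k)$ for $1\le k<s$; $\alpha^{(1,s)}_{(\vec{x}_1,\mu_1)}(\vec{x}_{s},\mu_{s})=(c_{s}^{q_{1}(\vec{x}_1,\mu_1)}(\vec{x}_{s}),\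 \mu_{s}+v_{s}((\operatorname{id}+c_{s}+\dots+c_{s}^{q_{1}(\vec{x}_1,\mu_1)-1})(\vec{x}_{s}))^t)$; and $\alpha^{(j,i)}_{(\vec x_j,\mu_j)}=\operatorname{id}_{H_i}$ for all other $(j,i)$. (The sum is over exponents $0,\dots,N-1$, where $N\ge0$ is any integer representative of $q_1(\vec x_1,\mu_1)\in\mathbb{Z}/(p_1^{r_1})$; this is well defined.) The left brace. $H_1\bowtie\dots\bowtie H_s$ is the iterated matched product of left ideals determined by the maps $\alpha^{(j,i)}$. Explicitly, its additive group is $H_1\times\dots\times H_s$ with componentwise addition, its multiplication is $x\cdot y=x+\lambda_x(y)$, and for $h_k,h_k'\in H_k$ the $i$-th component of $\lambda_{(h_1,\dots,h_s)}(h_1',\dots,h_s')$ is $\lambda^{(i)}_{h_i}\alpha^{(i+1,i)}_{h_{i+1}}(h_i')$ for $1\le i<s$ and $\lambda^{(s)}_{h_s}\alpha^{(1,s)}_{h_1}(h_s')$ for $i=s$. Each factor $H_i$ (embedded in the $i$-th coordinate) is a left ideal. *)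

(* Defs.v *)
From HB Require Import structures.
From mathcomp Require Import all_boot all_order all_fingroup all_algebra cyclic.

Set Implicit Arguments.
Unset Strict Implicit.
Unset Printing Implicit Defensive.

Import GRing.Theory.
Local Open Scope ring_scope.

HB.mixin Record Zmodule_Group_isLeftBrace B of GRing.Zmodule B & monoid.Group B := {
  brace_compat : forall a b c : B, (a * (b + c))%g + a = (a * b)%g + (a * c)%g
}.

#[short(type="leftBraceType")]
HB.structure Definition LeftBrace :=
  {B of Zmodule_Group_isLeftBrace B & GRing.Zmodule B & monoid.Group B}.

Definition lambda (B : leftBraceType) (a b : B) : B := (a * b)%g - a.

(* Subsets are boolean predicates, as in group_closed. *)
Definition ideal (B : leftBraceType) (I : {pred B}) : Prop :=
  [/\ group_closed I,
      forall a b : B, a \in I -> (a ^ b)%g \in I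
    & forall a b : B, a \in I -> lambda b a \in I].

Definition simple_brace (B : leftBraceType) : Prop :=
  (exists a : B, a != 0)
  /\ forall I : {pred B}, ideal I -> I =i pred1 0 \/ I =i predT.

(* The left brace with prescribed lambda map, a * b = a + lam a b. *)
HB.factory Record Zmodule_isLambdaBrace B of GRing.Zmodule B := {
  lam : B -> B -> B;
  lamD : forall a, {morph lam a : x y / x + y};
  lam_bij : forall a, bijective (lam a);
  lamM : forall a b x, lam (a + lam a b) x = lam a (lam b x)
}.

HB.builders Context B of Zmodule_isLambdaBrace B.

Let mul (a b : B) := a + lam a b.

Let lam0 a : lam a 0 = 0.
Proof. by apply: (addrI (lam a 0)); rewrite -lamD !addr0. Qed.

Let lam0l x : lam 0 x = x.
Proof.
have [g gK _] := lam_bij 0.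
by apply: (can_inj gK); rewrite -lamM lam0 addr0.
Qed.

Let mulA : associative mul.
Proof. by move=> a b c; rewrite /mul lamD lamM addrA. Qed.

Let mul1 : left_id 0 mul.
Proof. by move=> a; rewrite /mul lam0l add0r. Qed.

Let mul1r : right_id 0 mul.
Proof. by move=> a; rewrite /mul lam0 addr0. Qed.

Let ex_inv a : exists b, mul a b == 0.
Proof.
have [g _ gK] := lam_bij a.
by exists (g (- a)); rewrite /mul gK subrr.
Qed.

Let inv a := xchoose (ex_inv a).

Let mulV a : mul a (inv a) = 0.
Proof. exact/eqP/(xchooseP (ex_inv a)). Qed.

Let mulVl a : mul (inv a) a = 0.
Proof.
have e : inv (inv a) = a.
  by rewrite -[LHS]mul1 -(mulV a) -mulA mulV mul1r.
by rewrite -{2}e mulV.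
Qed.

HB.instance Definition _ := isGroup.Build B mulA mul1 mul1r mulVl mulV.

Let compat (a b c : B) : (a * (b + c))%g + a = (a * b)%g + (a * c)%g.
Proof.
rewrite -[(a * _)%g]/(a + lam a (b + c)) -[(a * b)%g]/(a + lam a b).
by rewrite -[(a * c)%g]/(a + lam a c) lamD [LHS]addrC [RHS]addrACA -addrA.
Qed.

HB.instance Definition _ := Zmodule_Group_isLeftBrace.Build B compat.

HB.end.

(* 'Z_m is Z/m only for m > 1; below m = p ^ r with p prime and 0 < r. *)
Section QuadraticForms.
Variables m n : nat.
Implicit Types (Q : 'rV['Z_m]_n -> 'Z_m) (x y : 'rV['Z_m]_n).

Definition polar Q x y : 'Z_m := Q (x + y) - Q x - Q y.

(* polar Q is symmetric, so linearity in one variable gives bilinearity *)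
Definition quadratic_form Q : Prop :=
  (forall a x, Q (a *: x) = a ^+ 2 * Q x) /\ (forall x, scalar (polar Q x)).

Definition nondegenerate Q : Prop :=
  \matrix_(i < n, j < n) polar Q (delta_mx 0 i) (delta_mx 0 j) \in unitmx.

(* 'rV['Z_m]_n is here a finGroupType under addition, so that Aut [set: _] is
   the automorphism group of the additive group, as a set of permutations. *)
Definition orthogonal_group Q : {set {perm 'rV['Z_m]_n}} :=
  [set g in Aut [set: 'rV['Z_m]_n] | [forall x, Q (g x) == Q x]].

End QuadraticForms.

Record Hdata (p r n : nat) := {
  p_prime : prime p;
  r_gt0 : (0 < r)%N;
  n_gt0 : (0 < n)%N;
  Qf : 'rV['Z_(p ^ r)]_n -> 'Z_(p ^ r);
  Qf_quadratic : quadratic_form Qf;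
  Qf_nondegenerate : nondegenerate Qf;
  ff : {perm 'rV['Z_(p ^ r)]_n};
  ff_orthogonal : ff \in orthogonal_group Qf;
  ff_order : exists2 r' : nat, (r' <= r)%N & #[ff]%g = (p ^ r')%N
}.

Lemma expg_Zp (gT : finGroupType) (x : gT) m (a b : 'Z_m) :
  (#[x]%g %| (Zp_trunc m).+2)%N -> (x ^+ (a + b)%R = x ^+ a * x ^+ b)%g.
Proof.
by move=> dv; rewrite -expgD -[RHS](@expg_mod _ (Zp_trunc m).+2) //; apply/eqP; rewrite -order_dvdn.
Qed.

Section PolarTheory.
Variables m n : nat.
Variable Q : 'rV['Z_m]_n -> 'Z_m.
Hypothesis Qq : quadratic_form Q.
Implicit Types x y z : 'rV['Z_m]_n.

Lemma polarC x y : polar Q x y = polar Q y x.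
Proof. by rewrite /polar [y + x]addrC addrAC. Qed.

Lemma polarDr x y z : polar Q x (y + z) = polar Q x y + polar Q x z.
Proof. by have /(_ 1 y z) := Qq.2 x; rewrite scale1r /= mul1r. Qed.

Lemma polarDl x y z : polar Q (x + y) z = polar Q x z + polar Q y z.
Proof. by rewrite ![polar Q _ z]polarC polarDr. Qed.

Lemma quadraticD x y : Q (x + y) = Q x + Q y + polar Q x y.
Proof. by rewrite /polar -(addrA (Q (x + y))) -opprD [RHS]addrC subrK. Qed.

End PolarTheory.

Definition Hcarrier p r n (X : Hdata p r n) : Type :=
  ('rV['Z_(p ^ r)]_n * 'Z_(p ^ r))%type.

HB.instance Definition _ p r n (X : Hdata p r n) :=
  GRing.Zmodule.copy (Hcarrier X) ('rV['Z_(p ^ r)]_n * 'Z_(p ^ r))%type.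

Section HBrace.
Variables (p r n : nat) (X : Hdata p r n).
Implicit Types h : Hcarrier X.

Definition qf h : 'Z_(p ^ r) := h.2 - Qf X h.1.

(* The exponent qf h is used through its representative in [0, p ^ r). *)
Definition lamH h h' : Hcarrier X :=
  ((ff X ^+ qf h)%g h'.1, h'.2 + polar (Qf X) h.1 ((ff X ^+ qf h)%g h'.1)).

Lemma trunc_ppow : (Zp_trunc (p ^ r)).+2 = (p ^ r)%N.
Proof.
by apply: Zp_cast; rewrite -{1}(expn0 p) ltn_exp2l ?(r_gt0 X) // prime_gt1 ?(p_prime X).
Qed.

Lemma aut_add (g : {perm 'rV['Z_(p ^ r)]_n}) :
  g \in Aut [set: 'rV['Z_(p ^ r)]_n] -> {morph g : x y / x + y}.
Proof.
by move=> gA x y; have /morphicP := Aut_morphic gA; apply; rewrite inE.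
Qed.

Lemma ffX_orth k : (ff X ^+ k)%g \in orthogonal_group (Qf X).
Proof.
have := ff_orthogonal X; rewrite in_set => /andP[fA /forallP fQ].
rewrite in_set; apply/andP; split.
  exact: (@groupX _ [Aut [set: 'rV['Z_(p ^ r)]_n]]).
apply/forallP => x; elim: k => [|k IH]; first by rewrite perm1.
by rewrite expgSr permM (eqP (fQ _)).
Qed.

Lemma ffX_add k : {morph (ff X ^+ k)%g : x y / x + y}.
Proof. by have := ffX_orth k; rewrite in_set => /andP[/aut_add]. Qed.

Lemma ffXQ k x : Qf X ((ff X ^+ k)%g x) = Qf X x.
Proof. by have := ffX_orth k; rewrite in_set => /andP[_ /forallP/(_ x)/eqP]. Qed.

Lemma ffX_polar k x y :
  polar (Qf X) ((ff X ^+ k)%g x) ((ff X ^+ k)%g y) = polar (Qf X) x y.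
Proof. by rewrite /polar -ffX_add !ffXQ. Qed.

Lemma ffXD (a b : 'Z_(p ^ r)) : (ff X ^+ (a + b)%R = ff X ^+ a * ff X ^+ b)%g.
Proof.
apply: expg_Zp; move: (#[_]%g) (ff_order X) => o o_ord; rewrite trunc_ppow.
by case: o_ord => r' le_r' ->; rewrite dvdn_exp2l.
Qed.

Lemma qfM h h' : qf (h + lamH h h') = qf h + qf h'.
Proof.
rewrite /qf [(h + _).1]/= [(h + _).2]/= (quadraticD (Qf X)) ffXQ.
set a := h.2; set b := h'.2; set c := Qf X h.1; set d := Qf X h'.1.
set e := polar _ _ _.
by rewrite addrA opprD addrACA subrr addr0 opprD addrACA.
Qed.

Lemma lamHD h : {morph lamH h : x y / x + y}.
Proof.
move=> x y; congr pair; rewrite /= ffX_add //.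
by rewrite (polarDr (Qf_quadratic X)) addrACA.
Qed.

Lemma lamH_bij h : bijective (lamH h).
Proof.
exists (fun y => ((ff X ^+ qf h)^-1%g y.1, y.2 - polar (Qf X) h.1 y.1)) => [[x a]|[x a]];
  by rewrite /lamH /= ?permK ?permKV ?addrK ?subrK.
Qed.

Lemma lamHM h h' x : lamH (h + lamH h h') x = lamH h (lamH h' x).
Proof.
rewrite /lamH; move: (qfM h h') => qE; rewrite qE (addrC (qf h)) ffXD permM.
move: (qf h) (qf h') => k k'; congr pair; rewrite [(h + _).1]/= [(_, _).1]/= [(_, _).2]/=.
by rewrite (polarDl (Qf_quadratic X)) ffX_polar addrCA addrC.
Qed.

HB.instance Definition _ :=
  Zmodule_isLambdaBrace.Build (Hcarrier X) lamHD lamH_bij lamHM.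

End HBrace.

Lemma lambdaH p r n (X : Hdata p r n) (h h' : Hcarrier X) :
  lambda h h' = lamH h h'.
Proof. by rewrite /lambda -[(h * h')%g]/(h + lamH h h') addrC addKr. Qed.

(* Indices 1, ..., s are represented by 'I_s = {0, ..., s - 1}; ordS is the
   cyclic successor, so that ordS i is i + 1, or the first index if i is the
   last one.  Only the vector vv i with i the last index is part of the data:
   the other components of vv are never used. *)
Record bowtie_data (s : nat) := {
  pp : 'I_s -> nat;
  rr : 'I_s -> nat;
  nn : 'I_s -> nat;
  hd : forall i, Hdata (pp i) (rr i) (nn i);
  pp_inj : injective pp;
  pp_odd : forall i : 'I_s, (i.+1 < s)%N -> odd (pp i);
  cc : forall i, {perm 'rV['Z_(pp i ^ rr i)]_(nn i)};
  cc_orthogonal : forall i : 'I_s, (i.+1 < s)%N ->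
    cc i \in orthogonal_group (Qf (hd i));
  cc_last_aut : forall i : 'I_s, i.+1 = s ->
    cc i \in Aut [set: 'rV['Z_(pp i ^ rr i)]_(nn i)];
  cc_order : forall i, #[cc i]%g = (pp (ordS i) ^ rr (ordS i))%N;
  vv : forall i, 'rV['Z_(pp i ^ rr i)]_(nn i);
  cc_last : forall i : 'I_s, i.+1 = s -> forall x,
    Qf (hd i) (cc i x) = Qf (hd i) x + (vv i *m x^T) 0 0;
  ff_cc_comm : forall i, commute (ff (hd i)) (cc i)
}.

(* The actions alpha^(i+1,i) and alpha^(1,s). *)
Definition alpha s (D : bowtie_data s) (i : 'I_s)
    (g : Hcarrier (hd D (ordS i))) (h : Hcarrier (hd D i)) :
    Hcarrier (hd D i) :=
  let N : nat := qf g in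
  ((cc D i ^+ N)%g h.1,
   if i.+1 == s then
     h.2 + (vv D i *m (\sum_(k < N) (cc D i ^+ k)%g h.1)^T) 0 0
   else h.2).

Definition bowtie s (D : bowtie_data s) : Type :=
  {dffun forall i : 'I_s, Hcarrier (hd D i)}.

HB.instance Definition _ s (D : bowtie_data s) := Choice.on (bowtie D).

Section BowtieZmodule.
Variables (s : nat) (D : bowtie_data s).
Implicit Types x y z : bowtie D.

Definition bowtie_mk (F : forall i, Hcarrier (hd D i)) : bowtie D :=
  finfun F.

Lemma bowtie_mkE F i : bowtie_mk F i = F i.
Proof. exact: ffunE. Qed.

Lemma bowtieP x y : (forall i, x i = y i) -> x = y.
Proof. by move=> e; apply/ffunP. Qed.

Let add x y := bowtie_mk (fun i => x i + y i).
Let zero := bowtie_mk (fun i => 0).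
Let opp x := bowtie_mk (fun i => - x i).

Let addA : associative add.
Proof. by move=> x y z; apply: bowtieP => i; rewrite !bowtie_mkE addrA. Qed.

Let addC : commutative add.
Proof. by move=> x y; apply: bowtieP => i; rewrite !bowtie_mkE addrC. Qed.

Let add0 : left_id zero add.
Proof. by move=> x; apply: bowtieP => i; rewrite !bowtie_mkE add0r. Qed.

Let addN : left_inverse zero opp add.
Proof. by move=> x; apply: bowtieP => i; rewrite !bowtie_mkE addNr. Qed.

HB.instance Definition _ :=
  GRing.isZmodule.Build (bowtie D) addA addC add0 addN.

Lemma bowtieD x y i : (x + y) i = x i + y i.
Proof. exact: bowtie_mkE. Qed.

End BowtieZmodule.

Section BowtieBrace.
Variables (s : nat) (D : bowtie_data s).
Implicit Types x y z : bowtie D.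

Definition lam_bowtie x y : bowtie D :=
  bowtie_mk (fun i => lambda (x i) (alpha (x (ordS i)) (y i))).

Section Index.
Variable i : 'I_s.
Local Notation Q := (Qf (hd D i)).
Local Notation c := (cc D i).

Lemma ccX_aut k : (c ^+ k)%g \in Aut [set: 'rV['Z_(pp D i ^ rr D i)]_(nn D i)].
Proof.
apply: (@groupX _ [Aut [set: 'rV['Z_(pp D i ^ rr D i)]_(nn D i)]]).
have [lt_is|] := ltnP i.+1 s.
  by have := cc_orthogonal D lt_is; rewrite in_set => /andP[].
by move=> le_si; apply: (@cc_last_aut _ D); apply/eqP; rewrite eqn_leq ltn_ord.
Qed.

Lemma ccX_add k : {morph (c ^+ k)%g : x y / x + y}.
Proof. exact: aut_add (ccX_aut k). Qed.

Lemma ccQ u : Q (c u) = Q u + (if i.+1 == s then (vv D i *m u^T) 0 0 else 0).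
Proof.
case: eqP => [e|ne]; first by have := @cc_last _ D i e u.
have lt_is : (i.+1 < s)%N by rewrite ltn_neqAle ltn_ord andbT; apply/eqP.
have := cc_orthogonal D lt_is; rewrite in_set => /andP[_ /forallP/(_ u)/eqP ->].
by rewrite addr0.
Qed.

Lemma dotD (u v : 'rV_(nn D i)) : (vv D i *m (u + v)^T) 0 0 =
  (vv D i *m u^T) 0 0 + (vv D i *m v^T) 0 0.
Proof. by rewrite linearD /= mulmxDr [LHS]mxE. Qed.

Lemma ccXQ k u : Q ((c ^+ k)%g u) =
  Q u + (if i.+1 == s
         then (vv D i *m (\sum_(j < k) (c ^+ j)%g u)^T) 0 0 else 0).
Proof.
elim: k => [|k IH].
  by rewrite perm1 big_ord0 trmx0 mulmx0 mxE if_same addr0.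
rewrite expgSr permM ccQ IH -addrA; congr (_ + _).
case: ifP => _; last by rewrite addr0.
by rewrite big_ord_recr dotD.
Qed.

Lemma alphaE (g : Hcarrier (hd D (ordS i))) h :
  alpha g h = ((c ^+ qf g)%g h.1, h.2 + (Q ((c ^+ qf g)%g h.1) - Q h.1)).
Proof.
congr pair; rewrite ccXQ [Q _ + _]addrC addrK.
by case: ifP; rewrite ?addr0.
Qed.

Lemma ccX_polar k u v : polar Q ((c ^+ k)%g u) ((c ^+ k)%g v) = polar Q u v.
Proof.
rewrite /polar -ccX_add !ccXQ.
set A := if _ then _ else _; set A1 := if _ then _ else _; set A2 := if _ then _ else _.
have -> : A = A1 + A2.
  rewrite /A /A1 /A2; case: ifP => _; last by rewrite addr0.
  under eq_bigr do rewrite ccX_add.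
  by rewrite big_split dotD.
rewrite -[LHS]addrA -opprD [Q u + A1 + _]addrACA opprD [LHS]addrACA subrr addr0.
by rewrite opprD addrA.
Qed.

Lemma qf_alpha (g : Hcarrier (hd D (ordS i))) h : qf (alpha g h) = qf h.
Proof.
rewrite alphaE; move: (qf g : nat) => k; rewrite /qf [(_, _).1]/= [(_, _).2]/=.
by rewrite [Q _ - _]addrC addrA addrK.
Qed.

Lemma ccXD (a b : 'Z_(pp D (ordS i) ^ rr D (ordS i))) :
  (c ^+ (a + b)%R = c ^+ a * c ^+ b)%g.
Proof.
apply: expg_Zp; move: (#[_]%g) (cc_order D i) => o ->.
by rewrite (trunc_ppow (hd D (ordS i))).
Qed.

Lemma alphaD (g : Hcarrier (hd D (ordS i))) : {morph alpha g : x y / x + y}.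
Proof.
move=> x y; rewrite !alphaE; move: (qf g : nat) => k; congr pair.
  exact: ccX_add.
rewrite [(x + y).1]/= [(x + y).2]/= ccX_add !quadraticD ccX_polar.
set a := Q _; set b := Q _; set a' := Q x.1; set b' := Q y.1; set e := polar _ _ _.
rewrite [(_, _).2]/= [in RHS]addrACA; congr (_ + _).
by rewrite opprD addrACA subrr addr0 opprD addrACA.
Qed.

Lemma alpha_bij (g : Hcarrier (hd D (ordS i))) : bijective (@alpha s D i g).
Proof.
set k := qf g : nat.
exists (fun h : Hcarrier (hd D i) => let u := (c ^+ k)^-1%g h.1 in
   (u, h.2 - (Q h.1 - Q u))) => [[u a]|[u a]]; rewrite alphaE -/k.
  by rewrite /= permK addrK.
by rewrite /= permKV subrK.
Qed.

Lemma alpha_comp (g g' g'' : Hcarrier (hd D (ordS i))) h :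
  qf g'' = qf g + qf g' -> alpha g'' h = alpha g (alpha g' h).
Proof.
move=> qE; rewrite !alphaE qE (addrC (qf g)) ccXD permM.
move: (_ ^+ _)%g (_ ^+ _)%g => a b; congr pair.
rewrite [(_, _).1]/= [(_, _).2]/= -[RHS]addrA; congr (_ + _).
by rewrite [RHS]addrC addrA subrK.
Qed.

Lemma alphaM (g g' : Hcarrier (hd D (ordS i))) (h : Hcarrier (hd D i)) :
  alpha (g * g')%g h = alpha g (alpha g' h).
Proof. exact/alpha_comp/qfM. Qed.

Lemma alpha_lam (g : Hcarrier (hd D (ordS i))) h h' :
  alpha g (lamH h h') = lamH (alpha g h) (alpha g h').
Proof.
rewrite {1}/lamH [RHS]/lamH qf_alpha !alphaE.
move: (qf g : nat) (qf h : nat) => k l; rewrite [(_, _).1]/= [(_, _).2]/=.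
have cfE u : (ff (hd D i) ^+ l)%g ((c ^+ k)%g u) = (c ^+ k)%g ((ff (hd D i) ^+ l)%g u).
  rewrite -!permM; congr (fun_of_perm _ u).
  exact/commuteX2/commute_sym/ff_cc_comm.
rewrite !cfE; congr pair; rewrite [(_, _).1]/= [(_, _).2]/= ccX_polar [RHS]addrAC; congr (_ + _ + (_ - _)).
- by rewrite -cfE ffXQ.
- by rewrite ffXQ.
Qed.

End Index.

Lemma lam_bowtieE x y i :
  lam_bowtie x y i = lamH (x i) (alpha (x (ordS i)) (y i)).
Proof. by rewrite bowtie_mkE lambdaH. Qed.

Lemma lam_bowtieD x : {morph lam_bowtie x : y z / y + z}.
Proof.
move=> y z; apply: bowtieP => i.
by rewrite bowtieD !lam_bowtieE bowtieD alphaD lamHD.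
Qed.

Lemma lam_bowtie_bij x : bijective (lam_bowtie x).
Proof.
have inj : injective (lam_bowtie x).
  move=> y z e; apply: bowtieP => i; have := congr1 (fun w : bowtie D => w i) e.
  rewrite !lam_bowtieE => /(bij_inj (lamH_bij _)).
  exact: (bij_inj (alpha_bij _)).
exact: (@injF_bij {dffun forall i : 'I_s, Hcarrier (hd D i)}).
Qed.

Lemma qf_bowtie x y i : qf ((x + lam_bowtie x y) i) = qf (x i) + qf (y i).
Proof. by rewrite bowtieD lam_bowtieE qfM qf_alpha. Qed.

Lemma lam_bowtieM x y z :
  lam_bowtie (x + lam_bowtie x y) z = lam_bowtie x (lam_bowtie y z).
Proof.
apply: bowtieP => i; rewrite !lam_bowtieE.
rewrite bowtieD lam_bowtieE lamHM alpha_lam.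
by congr (lamH _ (lamH _ _)); apply: alpha_comp; rewrite qf_bowtie.
Qed.

HB.instance Definition _ := Zmodule_isLambdaBrace.Build (bowtie D)
  lam_bowtieD lam_bowtie_bij lam_bowtieM.

Lemma lambda_bowtie x y i :
  lambda x y i = lambda (x i) (alpha (x (ordS i)) (y i)).
Proof.
by rewrite /lambda -[(x * y)%g]/(x + lam_bowtie x y) addrC addKr bowtie_mkE.
Qed.

End BowtieBrace.

(* Main.v *)
Require Import Defs.
From HB Require Import structures.
From mathcomp Require Import all_boot all_order all_fingroup all_algebra cyclic.
From mathcomp Require Import pgroup sylow.

(** Write V_i for the module (Z/p_i^r_i)^n_i and b_i for the polar form of Q_i,
    so that H_i = V_i x Z/p_i^r_i additively.

    Suppose that every c_i - 1 is bijective, and let I be a nonzero ideal.  It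
    is an additive subgroup, and the orders p_i^r_i are pairwise coprime, so I
    is the sum of its intersections I_i with the factors H_i ([ideal_proj]).
    A difference lambda_a(b) - b lies in I as soon as a or b does.  Taking b in
    I, inside H_i, an element (x, mu) of I_i yields all (0, b_i(z, x))
    ([ideal_shear]).  Taking a in I, between neighbours, an element (0, mu) of
    I_(i+1) yields elements ((c_i^mu - 1) x, nu) of I_i for all x in V_i
    ([ideal_cc_sub]).  If mu <> 0 then c_i^mu <> 1, because c_i has
    order p_(i+1)^r_(i+1).  As this order is prime to p_i, the nontrivial
    automorphism c_i^mu of the p_i-group V_i is nontrivial already on the socle,
    the subgroup of elements killed by p_i ([coprime_addperm_eq1]).  The socle
    being p_i^(r_i - 1) V_i, some (c_i^mu - 1) x lies outside p_i V_i, and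
    nondegeneracy of b_i turns it into an element (0, u) of I_i with u a unit;
    hence I_i contains all (0, t) ([axis_step]).  Going around the cycle of
    indices, this holds at all i; and then the neighbours with mu = 1, together
    with surjectivity of c_i - 1, give I_i = H_i ([nonzero_ideal_full]).

    Conversely, suppose that c_i - 1 is not injective.  Its kernel is a
    nonzero p_i-group, on which f_i acts because f_i and c_i commute.  As f_i
    has p_i-power order, it fixes some z <> 0 in this kernel ([fixed_vector]).
    Both f_i and c_i preserve b_i and fix z, so that h |-> b_i(z, x_i), where
    x_i is the V_i-component of h, is unchanged by lambda maps and thus a
    morphism for both group laws.  Its kernel is an ideal; it contains the
    element (0, 1) of H_i, and it is proper because b_i is nondegenerate. *)

Set Implicit Arguments.
Unset Strict Implicit.
Unset Printing Implicit Defensive.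

Import GRing.Theory.
Local Open Scope ring_scope.

(** * Automorphisms of abelian p-groups *)

Lemma mulrn_coprime (V : zmodType) (x : V) a b :
  (0 < a)%N -> coprime a b -> x *+ a = 0 -> x *+ b = 0 -> x = 0.
Proof.
move=> a_gt0 /(coprimeP _ a_gt0)[[u v] /= uv1] xa xb.
rewrite -[x]mulr1n -uv1 mulrnBr; last by apply: ltnW; rewrite -subn_gt0 uv1.
by rewrite (mulnC u) (mulnC v) !mulrnA xa xb !mul0rn subrr.
Qed.

Section AdditivePermutation.
Variables (V : finZmodType) (g : {perm V}).
Hypothesis gD : {morph g : x y / x + y}.

Lemma addperm0 : g 0 = 0.
Proof. by apply: (addrI (g 0)); rewrite -gD !addr0. Qed.

Lemma addpermB : {morph g : x y / x - y}.
Proof. by move=> x y; apply: (addIr (g y)); rewrite -gD !subrK. Qed.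

Lemma addpermMn k : {morph g : x / x *+ k}.
Proof.
by move=> x; elim: k => [|k IH]; rewrite ?mulr0n ?addperm0 // !mulrS gD IH.
Qed.

(** By induction on k, g fixes every x killed by l^k.  If l x is fixed, then
    d = g x - x is killed by l, hence fixed, and g^j x = x + j d for all j; for
    j the order of g this gives j d = 0 with j prime to l, so that d = 0. *)
Lemma coprime_addperm_eq1 (l r : nat) :
    prime l -> coprime l #[g]%g -> (forall x : V, x *+ (l ^ r) = 0) ->
    (forall x : V, x *+ l = 0 -> g x = x) -> g = 1%g.
Proof.
move=> l_pr co_lg lrV g_fix.
have fix_lk k : forall x : V, x *+ (l ^ k) = 0 -> g x = x.
  elim: k => [|k IH] x xlk; first by rewrite -[x]mulr1n -(expn0 l) xlk addperm0.
  have dl : (g x - x) *+ l = 0.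
    by rewrite mulrnBl -addpermMn IH ?subrr // -mulrnA -expnS.
  have gX j : (g ^+ j)%g x = x + (g x - x) *+ j.
    elim: j => [|j IHj]; first by rewrite perm1 mulr0n addr0.
    by rewrite expgSr permM IHj gD (addpermMn j) (g_fix _ dl) mulrS addrA addrCA subrr addr0.
  apply/eqP; rewrite -subr_eq0; apply/eqP.
  apply: (mulrn_coprime (prime_gt0 l_pr) co_lg dl).
  by apply: (addrI x); rewrite -gX expg_order perm1 addr0.
by apply/permP => x; rewrite perm1 (fix_lk r) ?lrV.
Qed.

(** The number of fixed points is divisible by p, and 0 is one of them. *)
Lemma p_element_fixed_point (S : {set V}) (p : nat) :
    prime p -> (exists k, #[g]%g = (p ^ k)%N) ->
    (p %| #|S|)%N -> 0 \in S -> (forall x, x \in S -> g x \in S) ->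
  exists2 z, z \in S & z != 0 /\ g z = z.
Proof.
move=> p_pr [k og] p_dv S0 gS.
have pG : (p.-group <[g]>)%g by rewrite /pgroup -orderE og pnatX pnat_id.
have act : [acts <[g]>, on S | 'P]%g.
  rewrite cycle_subG; apply/astabsP => x /=; rewrite /aperm.
  apply/idP/idP => [gx|]; last exact: gS.
  (* g maps S onto itself because g^-1 is a power of g *)
  have -> : x = (g ^+ #[g].-1)%g (g x).
    by rewrite -permM -expgS prednK ?order_gt0 // expg_order perm1.
  elim: _.-1 => [|j IHj]; first by rewrite perm1.
  by rewrite expgSr permM gS.
have := pgroup_fix_mod pG act; rewrite (eqP p_dv) => /esym/eqP pF.
have F0 : 0 \in ('Fix_(S | 'P)(<[g]>))%g.
  by rewrite inE S0 afix_cycle; apply/afix1P; rewrite /= /aperm addperm0.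
have : (1 < #|('Fix_(S | 'P)(<[g]>))%g|)%N.
  by rewrite (leq_trans (prime_gt1 p_pr)) // dvdn_leq //; apply/card_gt0P; exists 0.
rewrite (cardD1 0) F0 /= add1n ltnS => /card_gt0P[z].
rewrite inE => /andP[z0 /setIP[Sz]]; rewrite afix_cycle => /afix1P gz.
by exists z.
Qed.

End AdditivePermutation.

(** * Socles of modules over Z/p^r *)

Section PrimePower.
Variables (p r : nat).
Hypotheses (p_pr : prime p) (r_gt0 : (0 < r)%N).

Lemma ppow_gt1 : (1 < p ^ r)%N.
Proof. by rewrite -{1}(expn0 p) ltn_exp2l // prime_gt1. Qed.

Lemma Zp_natr_eq0 k : (k%:R == 0 :> 'Z_(p ^ r)) = (p ^ r %| k)%N.
Proof. by rewrite -val_eqE /= val_Zp_nat ?ppow_gt1. Qed.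

Lemma Zp_mulrn_eq0 (a : 'Z_(p ^ r)) k : (a *+ k == 0) = (p ^ r %| a * k)%N.
Proof. by rewrite -{1}[a]natr_Zp -mulrnA Zp_natr_eq0. Qed.

Lemma Zp_mulrn_ppow (a : 'Z_(p ^ r)) : a *+ (p ^ r) = 0.
Proof. by apply/eqP; rewrite Zp_mulrn_eq0 dvdn_mull. Qed.

Lemma Zp_unit_socle (a : 'Z_(p ^ r)) :
  a *+ (p ^ r.-1) != 0 -> a \is a GRing.unit.
Proof.
apply: contraR; rewrite -[in X in X -> _](natr_Zp a) unitZpE ?ppow_gt1 //.
rewrite coprime_pexpl // prime_coprime // negbK Zp_mulrn_eq0 => pa.
by rewrite -{1}(prednK r_gt0) expnS dvdn_mul.
Qed.

Lemma Zp_socle (a : 'Z_(p ^ r)) :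
  a *+ p = 0 -> exists b : 'Z_(p ^ r), a = b *+ (p ^ r.-1).
Proof.
move=> /eqP; rewrite Zp_mulrn_eq0 -{1}(prednK r_gt0) expnSr => pa.
have {}pa : (p ^ r.-1 %| a)%N by rewrite dvdn_pmul2r ?prime_gt0 in pa.
by exists (a %/ p ^ r.-1)%:R; rewrite -mulrnA divnK // natr_Zp.
Qed.

Lemma rV_mulrn_ppow n (x : 'rV['Z_(p ^ r)]_n) : x *+ (p ^ r) = 0.
Proof. by apply/rowP => j; rewrite mulmxnE mxE Zp_mulrn_ppow. Qed.

Lemma rV_socle n (x : 'rV['Z_(p ^ r)]_n) :
  x *+ p = 0 -> exists y, x = y *+ (p ^ r.-1).
Proof.
move=> xp.
have /fin_all_exists[F FE] j : exists b : 'Z_(p ^ r), x 0 j = b *+ (p ^ r.-1).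
  by apply: Zp_socle; rewrite -mulmxnE xp mxE.
by exists (\row_j F j); apply/rowP => j; rewrite mulmxnE mxE.
Qed.

End PrimePower.

(** * Nondegenerate quadratic forms *)

Section Polar.
Variables (m n : nat) (Q : 'rV['Z_m]_n -> 'Z_m).
Hypotheses (Qq : quadratic_form Q) (Qn : Defs.nondegenerate Q).
Implicit Types x y z : 'rV['Z_m]_n.

Lemma quadratic0 : Q 0 = 0.
Proof. by rewrite -(scale0r 0) Qq.1 expr0n mul0r. Qed.

Lemma polar0 x : polar Q x 0 = 0.
Proof. by rewrite /polar addr0 quadratic0 subrr subr0. Qed.

Lemma polarMn x y k : polar Q x (y *+ k) = polar Q x y *+ k.
Proof.
by elim: k => [|k IH]; rewrite ?mulr0n ?polar0 // !mulrS polarDr // IH.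
Qed.

Lemma polar_sumr (I : finType) x (F : I -> 'rV['Z_m]_n) (a : I -> 'Z_m) :
  polar Q x (\sum_i a i *: F i) = \sum_i a i * polar Q x (F i).
Proof.
apply: (big_rec2 (fun u v => polar Q x u = v)) => [|i u v _ <-].
  exact: polar0.
exact: Qq.2.
Qed.

Lemma polar_nondegenerate y : (forall x, polar Q x y = 0) -> y = 0.
Proof.
move=> y0.
rewrite -[LHS](mulmxK Qn); set M := (X in _ *m X *m _).
suff -> : y *m M = 0 by rewrite mul0mx.
(* the j-th coordinate of y M is b(y, e_j) = b(e_j, y) *)
apply/rowP => j; rewrite !mxE -[RHS](y0 (delta_mx 0 j)).
rewrite [in RHS](row_sum_delta y) polar_sumr.
by apply: eq_bigr => i _; rewrite mxE polarC.
Qed.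

Lemma polar_neq0 y : y != 0 -> exists x, polar Q x y != 0.
Proof.
move=> y0; apply/existsP; apply: contraR y0; rewrite negb_exists => /forallP xy0.
apply/eqP/polar_nondegenerate => x; apply/eqP; exact: negbNE (xy0 x).
Qed.

End Polar.

(** * Ideals of left braces *)

Section BraceIdeals.
Variable B : leftBraceType.
Implicit Types a b c : B.

Lemma brace_mulE a b : (a * b)%g = a + lambda a b.
Proof. by rewrite /lambda addrC subrK. Qed.

Lemma lambdaD a : {morph lambda a : b c / b + c}.
Proof.
move=> b c; apply: (addIr (a + a)).
by rewrite /lambda addrA subrK brace_compat addrACA !subrK.
Qed.

Lemma lambda0 a : lambda a 0 = 0.
Proof. by apply: (addrI (lambda a 0)); rewrite -lambdaD !addr0. Qed.

Lemma lambdaB a : {morph lambda a : b c / b - c}.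
Proof. by move=> b c; apply: (addIr (lambda a c)); rewrite -lambdaD !subrK. Qed.

Lemma brace_one : 1%g = 0 :> B.
Proof. by have := brace_mulE 1%g 0; rewrite mul1g lambda0 addr0. Qed.

Lemma lambdaVK a b : lambda a (lambda a^-1%g b) = b.
Proof.
by rewrite {2}/lambda lambdaB /lambda mulgA mulgV mul1g brace_one sub0r opprK subrK.
Qed.

Variable I : {pred B}.
Hypothesis I_ideal : ideal I.

Lemma ideal0 : 0 \in I.
Proof. by have [[]] := I_ideal; rewrite brace_one. Qed.

Lemma ideal_lambda a b : b \in I -> lambda a b \in I.
Proof. by have [_ _ ] := I_ideal; apply. Qed.

(** The product a * lambda_a^-1(b) equals a + b. *)
Lemma idealD a b : a \in I -> b \in I -> a + b \in I.
Proof.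
have [/group_closedM IM _ _] := I_ideal => Ia Ib.
by rewrite -(lambdaVK a b) -brace_mulE IM // ideal_lambda.
Qed.

Lemma idealN a : a \in I -> - a \in I.
Proof.
have [/group_closedV IV _ _] := I_ideal => Ia.
have -> : - a = lambda a a^-1%g by rewrite /lambda mulgV brace_one sub0r.
by rewrite ideal_lambda // IV.
Qed.

Lemma idealB a b : a \in I -> b \in I -> a - b \in I.
Proof. by move=> Ia Ib; rewrite idealD // idealN. Qed.

Lemma idealMn a k : a \in I -> a *+ k \in I.
Proof.
by move=> Ia; elim: k => [|k IH]; rewrite ?mulr0n ?ideal0 // mulrS idealD.
Qed.

(** Comparing a * b = a + lambda_a(b) with b * a^b = b + lambda_b(a^b) shows
    that lambda_a(b) - b = lambda_b(a^b) - a.  This is how normality of an ideal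
    is used below: its elements act trivially modulo the ideal. *)
Lemma ideal_lambda_sub a b : a \in I -> lambda a b - b \in I.
Proof.
move=> Ia; have [_ IJ _] := I_ideal.
have -> : lambda a b - b = lambda b (a ^ b)%g - a.
  apply: (addrI a); apply: (addIr b).
  rewrite -addrA subrK -brace_mulE [a + (_ - a)]addrC subrK addrC -brace_mulE.
  by rewrite conjgE mulgA mulgV mul1g.
by rewrite idealB // ideal_lambda // IJ.
Qed.

End BraceIdeals.

(** * The factors of the matched product *)

Section Bowtie.
Variables (s : nat) (D : bowtie_data s).
Local Notation B := (bowtie D).
Local Notation H i := (Hcarrier (hd D i)).

Lemma bowtie0 i : (0 : B) i = 0.
Proof. exact: bowtie_mkE. Qed.

Lemma bowtieB (x y : B) i : (x - y) i = x i - y i.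
Proof.
by apply: (addIr (y i)); rewrite -bowtieD !subrK.
Qed.

Lemma bowtieMn (x : B) k i : (x *+ k) i = x i *+ k.
Proof.
by elim: k => [|k IH]; rewrite ?mulr0n ?bowtie0 // !mulrS bowtieD IH.
Qed.

Definition emb i (h : H i) : B := bowtie_mk (dfwith (fun j => 0) h).

Lemma emb_in i (h : H i) : emb h i = h.
Proof. by rewrite bowtie_mkE dfwith_in. Qed.

Lemma emb_out i (h : H i) j : i != j -> emb h j = 0.
Proof. by move=> ij; rewrite bowtie_mkE dfwith_out. Qed.

Lemma bowtie_sum_emb (x : B) : x = \sum_i emb (x i).
Proof.
apply: bowtieP => j.
rewrite (big_morph (fun y : B => y j) (fun y z => bowtieD y z j) (bowtie0 j)).
rewrite (bigD1 j) //= big1 ?addr0 ?emb_in // => i ij.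
by rewrite emb_out.
Qed.

Lemma embB i (h k : H i) : emb (h - k) = emb h - emb k.
Proof.
apply: bowtieP => j; rewrite bowtieB; have [<-|ij] := eqVneq i j.
  by rewrite !emb_in.
by rewrite !emb_out // subrr.
Qed.

Lemma embMn i (h : H i) k : emb (h *+ k) = emb h *+ k.
Proof.
apply: bowtieP => j; rewrite bowtieMn; have [<-|ij] := eqVneq i j.
  by rewrite !emb_in.
by rewrite !emb_out // mul0rn.
Qed.

Lemma alpha0r i (g : H (ordS i)) : alpha g (0 : H i) = 0.
Proof. by apply: (addrI (alpha g 0)); rewrite -alphaD !addr0. Qed.

Lemma qf0 i : qf (0 : H i) = 0.
Proof. by rewrite /qf /= (quadratic0 (Qf_quadratic _)) subrr. Qed.

Lemma alpha0l i (h : H i) : alpha (0 : H (ordS i)) h = h.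
Proof. by rewrite alphaE qf0 expg0 perm1 subrr addr0; case: h. Qed.

Lemma lambda_emb (a : B) i (h : H i) :
  lambda a (emb h) = emb (lambda (a i) (alpha (a (ordS i)) h)).
Proof.
apply: bowtieP => j; rewrite lambda_bowtie; have [<-|ij] := eqVneq i j.
  by rewrite !emb_in.
by rewrite !emb_out // alpha0r lambda0.
Qed.

Lemma H_mulrn i (h : H i) : h *+ (pp D i ^ rr D i) = 0.
Proof.
have pP := p_prime (hd D i); have rP := r_gt0 (hd D i).
have -> k : h *+ k = (h.1 *+ k, h.2 *+ k).
  by elim: k => [|k IH]; rewrite ?mulr0n // !mulrS IH.
by rewrite rV_mulrn_ppow // Zp_mulrn_ppow.
Qed.

(** The projection to the i-th factor is multiplication by an integer which is
    1 modulo p_i^r_i and 0 modulo the p_j^r_j for j <> i. *)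
Lemma ideal_proj (I : {pred B}) : ideal I ->
  forall (a : B) i, a \in I -> emb (a i) \in I.
Proof.
move=> I_ideal a i Ia.
pose m j := (pp D j ^ rr D j)%N; pose M := (\prod_(j | j != i) m j)%N.
have co_mM : coprime (m i) M.
  apply: (big_ind (fun k => coprime (m i) k)) => [|k l ck cl|j ji].
  - exact: coprimen1.
  - by rewrite coprimeMr ck.
  rewrite coprimeXl // coprimeXr // prime_coprime ?(p_prime (hd D i)) //.
  rewrite dvdn_prime2 ?(p_prime (hd D _)) //; apply: contra ji => /eqP/pp_inj ->.
  exact: eqxx.
suff -> : emb (a i) = a *+ chinese (m i) M 1 0 by apply: idealMn.
apply: bowtieP => j; rewrite bowtieMn.
have [<-|ij] := eqVneq i j.
  rewrite emb_in (divn_eq (chinese _ _ _ _) (m i)) mulrnDr mulnC mulrnA H_mulrn.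
  rewrite mul0rn add0r chinese_modl // modn_small ?mulr1n //.
  exact: ppow_gt1 (p_prime (hd D i)) (r_gt0 (hd D i)).
rewrite emb_out //; have /dvdnP[q ->] : (m j %| chinese (m i) M 1 0)%N.
  apply: (@dvdn_trans M); first by rewrite /M (bigD1 j) 1?eq_sym //= dvdn_mulr.
  by rewrite /dvdn chinese_modr // mod0n.
by rewrite mulnC mulrnA H_mulrn mul0rn.
Qed.

End Bowtie.

(** * Nonzero ideals when every c_i - 1 is onto *)

Section Spread.
Variables (s : nat) (D : bowtie_data s).
Hypothesis s_ge2 : (2 <= s)%N.
Local Notation H i := (Hcarrier (hd D i)).
Local Notation V i := 'rV['Z_(pp D i ^ rr D i)]_(nn D i).
Local Notation Q i := (Qf (hd D i)).

Lemma ordS_neq (i : 'I_s) : ordS i != i.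
Proof.
rewrite -val_eqE /=; have [lt_is|le_si] := ltnP i.+1 s.
  by rewrite modn_small // neq_ltn ltnSn orbT.
have -> : i.+1 = s by apply/eqP; rewrite eqn_leq ltn_ord.
by rewrite modnn neq_ltn -ltnS (leq_trans s_ge2).
Qed.

Lemma ordS_ind (P : 'I_s -> Prop) :
  (forall i, P (ordS i) -> P i) -> (exists i, P i) -> forall i, P i.
Proof.
move=> PS [i0 P0] i.
have Pk k j : P (iter k (@ordS s) j) -> P j.
  elim: k j => [|k IH] j //; rewrite iterSr => /IH; exact: PS.
(* s - i + i0 cyclic steps lead from i to i0 *)
apply: (Pk (s - i + i0)%N).
suff -> : iter (s - i + i0) (@ordS s) i = i0 by [].
have vE k : (iter k (@ordS s) i : nat) = ((i + k) %% s)%N.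
  elim: k => [|k IH]; first by rewrite addn0 modn_small.
  by rewrite iterS /= IH -addn1 modnDml addn1 addnS.
by apply: val_inj; rewrite /= vE addnA subnKC 1?ltnW // modnDl modn_small.
Qed.

Lemma ccX_coprime i k : coprime (pp D i) #[(cc D i ^+ k)%g]%g.
Proof.
rewrite prime_coprime ?(p_prime (hd D i)) //.
apply/negP => /dvdn_trans/(_ (orderXdvd _ _)); rewrite cc_order.
rewrite Euclid_dvdX ?(p_prime (hd D i)) // => /andP[].
rewrite dvdn_prime2 ?(p_prime (hd D _)) // => /eqP/pp_inj ii _.
by have := ordS_neq i; rewrite -ii eqxx.
Qed.

Lemma ccX_neq1 i (mu : 'Z_(pp D (ordS i) ^ rr D (ordS i))) :
  mu != 0 -> (cc D i ^+ mu != 1)%g.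
Proof.
apply: contra; rewrite -order_dvdn cc_order => dv.
have lt := leq_trans (ltn_ord mu) (eq_leq (trunc_ppow (hd D (ordS i)))).
by rewrite -val_eqE /= -(modn_small lt).
Qed.

Variable I : {pred bowtie D}.
Hypothesis I_ideal : ideal I.

(** The element (z, Q_i(z)) of H_i has q_i = 0, hence its lambda map is the
    shear (x, mu) |-> (x, mu + b_i(z, x)). *)
Lemma ideal_shear i (x z : V i) mu :
  emb ((x, mu) : H i) \in I -> emb ((0, polar (Q i) z x) : H i) \in I.
Proof.
move=> Ix.
suff -> : emb ((0, polar (Q i) z x) : H i) =
    lambda (emb ((z, Q i z) : H i)) (emb ((x, mu) : H i)) - emb ((x, mu) : H i).
  by apply: idealB; rewrite // ideal_lambda.
rewrite lambda_emb emb_in emb_out 1?eq_sym ?ordS_neq // alpha0l lambdaH -embB.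
have qz : qf ((z, Q i z) : H i) = 0 by rewrite /qf /= subrr.
rewrite /lamH qz expg0 perm1; congr emb; apply: injective_projections => /=.
  by rewrite subrr.
by rewrite addrAC subrr add0r.
Qed.

(** Since q_(i+1)(0, mu) = mu, the element (0, mu) of H_(i+1) acts on V_i as
    c_i^mu. *)
Lemma ideal_cc_sub i (x : V i) mu :
  emb ((0, mu) : H (ordS i)) \in I ->
  exists nu, emb (((cc D i ^+ mu)%g x - x, nu) : H i) \in I.
Proof.
move=> Imu; have := ideal_lambda_sub I_ideal (emb ((x, 0) : H i)) Imu.
rewrite lambda_emb emb_in emb_out ?ordS_neq // alphaE lambdaH -embB.
have qmu : qf ((0, mu) : H (ordS i)) = mu.
  by rewrite /qf /= (quadratic0 (Qf_quadratic _)) subr0.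
rewrite /lamH qf0 expg0 perm1 qmu => Ic.
by eexists; apply: Ic.
Qed.

Lemma ideal_unit_axis i (u : 'Z_(pp D i ^ rr D i)) :
  u \is a GRing.unit -> emb ((0, u) : H i) \in I ->
  forall t, emb ((0, t) : H i) \in I.
Proof.
move=> uU Iu t; have := idealMn I_ideal (t / u) Iu.
rewrite -embMn; congr (emb _ \in I).
have HMn k : ((0, u) : H i) *+ k = ((0 : V i) *+ k, u *+ k).
  by elim: k => [|k IH]; rewrite ?mulr0n // !mulrS IH.
by rewrite HMn mul0rn -mulr_natl natr_Zp divrK.
Qed.

Definition contains_axis i := forall t, emb ((0, t) : H i) \in I.

(** The step from one factor to the preceding one: mu may be divisible by
    p_(i+1), and still I contains all (0, t) in H_i, because the order of
    c_i^mu is prime to p_i. *)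
Lemma axis_step i (mu : 'Z_(pp D (ordS i) ^ rr D (ordS i))) :
  mu != 0 -> emb ((0, mu) : H (ordS i)) \in I -> contains_axis i.
Proof.
move=> mu0 Imu.
have p_pr := p_prime (hd D i); have r0 := r_gt0 (hd D i).
set g := (cc D i ^+ mu)%g.
have gD : {morph g : x y / x + y} by exact: ccX_add.
(* otherwise c_i^mu would be the identity on the socle of V_i *)
have [x gx] : exists x : V i, (g x - x) *+ (pp D i ^ (rr D i).-1) != 0.
  apply/existsP; apply: contraR (ccX_neq1 mu0); rewrite negb_exists => /forallP g0.
  apply/eqP; apply: (coprime_addperm_eq1 gD p_pr (ccX_coprime i mu)).
    exact: rV_mulrn_ppow.
  move=> d /(rV_socle p_pr r0)[x ->].
  apply/eqP; rewrite (addpermMn gD) -subr_eq0 -mulrnBl.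
  by have := g0 x; rewrite negbK.
have [nu Inu] := ideal_cc_sub x Imu.
have [z zx] : exists z, polar (Q i) z ((g x - x) *+ (pp D i ^ (rr D i).-1)) != 0.
  exact: (polar_neq0 (Qf_quadratic (hd D i)) (Qf_nondegenerate (hd D i)) gx).
apply: (@ideal_unit_axis i (polar (Q i) z (g x - x))); last exact: ideal_shear Inu.
by apply: Zp_unit_socle; rewrite // -(polarMn (Qf_quadratic _)).
Qed.

Lemma nonzero_ideal_axis a : a \in I -> a != 0 -> forall i, contains_axis i.
Proof.
move=> Ia a0; apply: ordS_ind => [i Ci|].
  apply: (@axis_step i 1); first exact: oner_neq0.
  exact: Ci.
have [i ai] : exists i, a i != 0.
  apply/existsP; apply: contraR a0; rewrite negb_exists => /forallP ai.
  by apply/eqP/bowtieP => i; rewrite bowtie0; apply/eqP/negbNE/ai.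
(* [axis_step] starts from a factor whose index is a cyclic successor *)
rewrite -(ord_predK i) in ai; exists (ord_pred i); move: (ord_pred i) ai => {}i.
have := ideal_proj I_ideal (ordS i) Ia; move: (a (ordS i)) => [x mu] Ix xmu.
have [x0|x0] := eqVneq x 0.
  apply: (@axis_step i mu); last by rewrite -x0.
  by apply: contraNneq xmu => mu0; rewrite x0 mu0; exact: eqxx.
have [z zx] := polar_neq0 (Qf_quadratic _) (Qf_nondegenerate (hd D (ordS i))) x0.
by apply: axis_step zx _; exact: ideal_shear Ix.
Qed.

Lemma nonzero_ideal_full a :
    (forall i (y : V i), exists x, y = cc D i x - x) ->
  a \in I -> a != 0 -> I =i predT.
Proof.
move=> c_surj Ia a0 b; rewrite [RHS]inE (bowtie_sum_emb b).
apply: (big_ind (fun y => y \in I)) => [||i _].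
- exact: ideal0.
- exact: idealD.
(* (y, mu) is the difference of some (c_i x - x, nu) and (0, nu - mu) *)
have C := nonzero_ideal_axis Ia a0.
move: (b i) => [y mu]; have [x ->] := c_surj i y.
have [nu] := ideal_cc_sub x (C (ordS i) 1).
rewrite expg1 => Inu.
have := idealB I_ideal Inu (C i (nu - mu)); rewrite -embB.
congr (emb _ \in I); apply: injective_projections => /=; first exact: subr0.
by rewrite opprB addrC subrK.
Qed.

End Spread.

(** * The ideal attached to a vector fixed by f_i and c_i *)

Section FixedVector.
Variables (s : nat) (D : bowtie_data s) (i : 'I_s).
Local Notation V := 'rV['Z_(pp D i ^ rr D i)]_(nn D i).
Local Notation Q := (Qf (hd D i)).
Local Notation c := (cc D i).
Local Notation f := (ff (hd D i)).

(** The fixed points of c_i form a nonzero subgroup of V_i, hence a p_i-group,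
    stable under the p_i-element f_i. *)
Lemma fixed_vector (z0 : V) : z0 != 0 -> c z0 = z0 ->
  exists2 z : V, z != 0 & f z = z /\ c z = z.
Proof.
move=> z0n cz0.
have p_pr := p_prime (hd D i).
have cD : {morph c : x y / x + y} by have := @ccX_add _ D i 1; rewrite expg1.
have fD : {morph f : x y / x + y} by have := @ffX_add _ _ _ (hd D i) 1; rewrite expg1.
pose S := [set z : V | c z == z].
have gS : group_set S.
  apply/group_setP; split=> [|x y]; first by rewrite inE (addperm0 cD).
  by rewrite !inE => /eqP cx /eqP cy; apply/eqP; rewrite -[RHS](congr2 _ cx cy); exact: cD.
have [k _ Sk] : exists2 k, (k <= rr D i * nn D i)%N & #|S| = (pp D i ^ k)%N.
  apply/(dvdn_pfactor _ _ p_pr); rewrite expnM.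
  have <- : #|[set: V]| = ((pp D i ^ rr D i) ^ nn D i)%N.
    by rewrite cardsT card_mx mul1n card_ord; congr expn; exact: trunc_ppow (hd D i).
  exact: cardSg (subsetT (Group gS)).
have S0 : 0 \in S by exact: (group1 (Group gS)).
have Sz0 : z0 \in S by rewrite inE cz0.
have dvS : (pp D i %| #|S|)%N.
  rewrite Sk; case: k Sk => [|k] Sk; last by rewrite expnS dvdn_mulr.
  have : (1 < #|S|)%N by apply/card_gt1P; exists z0, 0.
  by rewrite Sk.
have [z] : exists2 z, z \in S & z != 0 /\ f z = z.
  apply: (p_element_fixed_point fD p_pr _ dvS S0).
    by have [r' _ fo] := ff_order (hd D i); exists r'.
  move=> x; rewrite !inE => /eqP cx.
  by rewrite -permM (ff_cc_comm D i) permM cx.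
by rewrite inE => /eqP cz [z_n0 fz]; exists z.
Qed.

Definition fixed_kernel (z : V) : {pred bowtie D} :=
  [pred h : bowtie D | polar Q z (h i).1 == 0].

(** Since f_i and c_i preserve the polar form and fix z, the map b_i(z, _) is
    invariant under all lambda maps, hence turns products into sums. *)
Lemma fixed_kernel_ideal (z : V) : f z = z -> c z = z -> ideal (fixed_kernel z).
Proof.
move=> fz cz; have Qq := Qf_quadratic (hd D i).
have fX k : (f ^+ k)%g z = z by elim: k => [|k IH]; rewrite ?perm1 // expgSr permM IH.
have cX k : (c ^+ k)%g z = z by elim: k => [|k IH]; rewrite ?perm1 // expgSr permM IH.
pose phi (h : bowtie D) := polar Q z (h i).1.
have phi_lam a b : phi (lambda a b) = phi b.
  rewrite /phi lambda_bowtie lambdaH alphaE /lamH /=.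
  by rewrite -{1}(fX (qf (a i))) ffX_polar -{1}(cX (qf (a (ordS i)))) ccX_polar.
have phiM a b : phi (a * b)%g = phi a + phi b.
  by rewrite brace_mulE -(phi_lam a b) /phi bowtieD polarDr.
have phi1 : phi 1%g = 0 by rewrite brace_one /phi bowtie0 polar0.
have phiV a : phi a^-1%g = - phi a.
  by apply: (addrI (phi a)); rewrite -phiM mulgV phi1 subrr.
split; first split.
- by rewrite inE; apply/eqP.
- by move=> a b; rewrite !inE => /eqP pa /eqP pb; rewrite -/(phi _) phiM phiV /phi pa pb subrr.
- move=> a b; rewrite !inE => /eqP pa; rewrite -/(phi _) conjgE !phiM phiV.
  by rewrite addrCA addNr addr0 /phi pa.
- by move=> a b; rewrite !inE -!/(phi _) phi_lam.
Qed.

(** A fixed vector of c_i would yield a z <> 0 for which the ideal above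
    contains (0, 1) in H_i, but not all of the brace. *)
Lemma simple_cc_fixed_eq0 : simple_brace (bowtie D) ->
  forall z : V, c z = z -> z = 0.
Proof.
move=> [_ simpleD] z0 cz0; apply/eqP; apply: contraT => z0n.
have [z z_n0 [fz cz]] := fixed_vector z0n cz0.
have Qq := Qf_quadratic (hd D i).
have [K0|KT] := simpleD _ (fixed_kernel_ideal fz cz).
  have := K0 (emb ((0, 1) : Hcarrier (hd D i))).
  rewrite !inE emb_in polar0 // eqxx => /esym/eqP/(congr1 (fun h : bowtie D => (h i).2)).
  by rewrite emb_in bowtie0 => /eqP; rewrite oner_eq0.
case/eqP: z_n0; apply: (polar_nondegenerate Qq (Qf_nondegenerate _)) => x.
have := KT (emb ((x, 0) : Hcarrier (hd D i))).
by rewrite !inE emb_in polarC => /eqP.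
Qed.

End FixedVector.

(** * The simplicity criterion *)

Theorem theorem3p6 (s : nat) (s_ge2 : (2 <= s)%N) (D : bowtie_data s) :
  simple_brace (bowtie D) <->
  forall i : 'I_s,
    exists2 g, g \in Aut [set: 'rV['Z_(pp D i ^ rr D i)]_(nn D i)]
             & forall x, g x = cc D i x - x.
Proof.
split=> [simpleD i | c_aut].
  have cD : {morph cc D i : x y / x + y} by have := @ccX_add _ D i 1; rewrite expg1.
  have c_inj : injective (fun x => cc D i x - x).
    move=> x y cxy; apply/eqP; rewrite -subr_eq0; apply/eqP.
    apply: (simple_cc_fixed_eq0 simpleD).
    rewrite (addpermB cD) -[cc D i x](subrK x) cxy.
    by rewrite addrAC [cc D i y - y]addrC addrK addrC.
  exists (perm c_inj); last by move=> x; rewrite permE.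
  rewrite inE; apply/andP; split; first by apply/subsetP => x; rewrite inE.
  by apply/morphicP => x y _ _; rewrite !permE cD opprD addrACA.
have i0 : 'I_s by case: (s) s_ge2 => // n _; exact: ord0.
split.
  exists (emb ((0, 1) : Hcarrier (hd D i0))); apply/eqP.
  move=> /(congr1 (fun h : bowtie D => (h i0).2)).
  by rewrite emb_in bowtie0 => /eqP; rewrite oner_eq0.
move=> I I_ideal.
(* the carrier is finite, so whether I is zero is decidable *)
case: (boolP [forall a : {dffun forall i : 'I_s, Hcarrier (hd D i)},
    (a \in I) ==> (a == 0 :> bowtie D)]) => [/forallP I0|].
  left=> a; rewrite [RHS]inE; apply/idP/eqP => [Ia|->]; last exact: ideal0.
  by apply/eqP; have /implyP := I0 a; apply.
rewrite negb_forall => /existsP[a]; rewrite negb_imply => /andP[Ia a0]; right.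
apply: (nonzero_ideal_full s_ge2 I_ideal _ Ia a0) => i y.
have [g _ gE] := c_aut i; exists (g^-1%g y).
by rewrite -gE permKV.
Qed.
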